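(* Suppose $Y$ is a continuous image of a product $X=\prod_{i\in I}X_i$ of compacta. Then $\chi_K Nt(Y)\leq\sup_{i\in I}w(X_i)$.
   Context: A compactum is a compact Hausdorff space; $w(\cdot)$ is weight. Families of open sets are ordered by inclusion; a family is $\kappa^{\mathrm{op}}$-like if no member is contained in $\kappa$-many members. For $E\subseteq Y$, $\chi Nt(E,Y)$ is the least $\kappa\geq\omega$ such that $E$ has a $\kappa^{\mathrm{op}}$-like neighborhood base (family of open sets containing $E$ such that every open set containing $E$ contains a member). $\chi_K Nt(Y)$ is the supremum of $\chi Nt(K,Y)$ over compact $K\subseteq Y$.
   Formalization: Y is assumed Hausdorff (so a compactum); for non-Hausdorff continuous images the inequality can fail. Weights are taken to be at least ω, and the bound is stated for every infinite cardinal that bounds all w(X_i). *)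

(* Defs.v *)
From HB Require Import structures.
From mathcomp Require Import all_boot all_order all_algebra.
From mathcomp Require Import all_classical all_reals all_analysis.
Set Implicit Arguments. Unset Strict Implicit. Unset Printing Implicit Defensive.
Local Open Scope classical_set_scope.
Local Open Scope card_scope.

Definition compactum (T : topologicalType) : Prop :=
  compact [set: T] /\ hausdorff_space T.

Definition is_base (T : topologicalType) (B : set (set T)) : Prop :=
  (forall b, B b -> open b) /\
  (forall U x, open U -> U x -> exists2 b, B b & b x /\ b `<=` U).

(* w(T) <= |L| for an infinite cardinal |L| (weight is taken >= omega,
   so for infinite L this is just the existence of a base of size <= |L|). *)
Definition weight_le (T : topologicalType) (L : Type) : Prop :=
  exists2 B : set (set T), is_base B & B #<= [set: L].

Definition op_like (T : Type) (L : Type) (F : set (set T)) : Prop :=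
  forall U, F U -> ~ ([set: L] #<= [set V | F V /\ U `<=` V]).

Definition nbhd_base (T : topologicalType) (E : set T) (F : set (set T)) : Prop :=
  (forall U, F U -> open U /\ E `<=` U) /\
  (forall W, open W -> E `<=` W -> exists2 U, F U & U `<=` W).

Definition chiNt_le (T : topologicalType) (E : set T) (L : Type) : Prop :=
  exists2 F : set (set T), nbhd_base E F & op_like L F.

Definition chiKNt_le (T : topologicalType) (L : Type) : Prop :=
  forall K : set T, compact K -> chiNt_le K L.

(* Main.v *)
Require Import Defs.
From HB Require Import structures.
From mathcomp Require Import all_boot all_order all_algebra.
From mathcomp Require Import all_classical all_reals all_analysis.
From mathcomp Require Import wochoice.
Set Implicit Arguments.
Unset Strict Implicit.
Unset Printing Implicit Defensive.
Local Open Scope classical_set_scope.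
Local Open Scope card_scope.

(** Let [C] be the preimage of [K] in the product.  Call a finite set [s] of
    coordinates critical if some point of [C] and some point outside [C] differ
    only on [s], and let [E] be a maximal disjoint family of critical sets.  By
    maximality [C] depends only on the coordinates in the union of [E], so that
    compactness gives [C], hence [K], a neighbourhood base of size at most
    [|E| + |L|].

    For [s] in [E] with witnesses [x_s] in [C] and [y_s] not in [C], the
    complement of the point [f y_s] is a neighbourhood of [K].  The preimage of a
    neighbourhood [V] of [K] contains a neighbourhood of [C] with finite support,
    and if [V] misses [f y_s] this support meets [s]; so [V] misses only finitely
    many of the points [f y_s].  If [|L| <= |E|], intersecting the members of a
    base indexed by [E] with these complements gives a base each of whose members
    is contained in only finitely many others.  If [|E| <= |L|], there is a base
    indexed by [L]; well-order [L] in its initial ordinal and keep [q l] only when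
    no earlier [q l'] is contained in it. *)

(** * Cardinal arithmetic *)

Definition embeds (A B : Type) : Prop := exists g : A -> B, injective g.

Lemma embeds_trans (B A C : Type) : embeds A B -> embeds B C -> embeds A C.
Proof. by move=> [g gI] [h hI]; exists (h \o g); exact: inj_comp. Qed.

Lemma embeds_prod (A B C D : Type) :
  embeds A C -> embeds B D -> embeds (A * B) (C * D).
Proof.
move=> [g gI] [h hI]; exists (fun p => (g p.1, h p.2)).
by move=> [a b] [a' b'] /= [/gI -> /hI ->].
Qed.

Lemma embeds_sum (A B C D : Type) :
  embeds A C -> embeds B D -> embeds (A + B) (C + D).
Proof.
move=> [g gI] [h hI].
exists (fun p => match p with inl a => inl (g a) | inr b => inr (h b) end).
by move=> [a|b] [a'|b'] //= [] => [/gI ->|/hI ->].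
Qed.

Lemma embeds_map_seq (A B : Type) : embeds A B -> embeds (seq A) (seq B).
Proof. by move=> [g gI]; exists (map g); exact: inj_map. Qed.

Lemma card_le_embeds (A B : Type) (S : set A) (T : set B) :
  S #<= T <-> exists g : S -> B, injective g /\ forall x, T (g x).
Proof.
split.
  move=> /card_leP[g]; exists (fun x => val (g x)); split.
    by move=> x y /val_inj/(inj (in_setT x) (in_setT y)).
  by move=> x; apply: set_mem; exact: valP.
move=> [g [gI gT]]; apply/card_leP.
pose h (x : S) : T := SigSub (mem_set (gT x)).
have hf : set_fun [set: S] [set: T] h by [].
have hi : set_inj [set: S] h by move=> x y _ _ /(congr1 val)/gI.
by apply/injfunPex; exists h.
Qed.

Lemma setT_card_leP (A B : Type) (T : set B) :
  [set: A] #<= T <-> exists g : A -> B, injective g /\ forall x, T (g x).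
Proof.
rewrite card_le_embeds; split=> -[g [gI gT]].
  exists (fun x => g (SigSub (in_setT x))); split=> // x y /gI.
  by move=> /(congr1 val).
exists (fun x => g (val x)); split=> // x y /gI; exact: val_inj.
Qed.

Lemma embedsP (A B : Type) : embeds A B <-> [set: A] #<= [set: B].
Proof.
rewrite setT_card_leP; split=> [[g gI]|[g [gI _]]]; last by exists g.
by exists g.
Qed.

(** Zorn's lemma yields a maximal graph of a partial injection. If it missed both some [a] and some
    [b], the pair [(a, b)] could be added. *)
Lemma embeds_total (A B : Type) : embeds A B \/ embeds B A.
Proof.
pose P (R : set (A * B)) := forall p q, R p -> R q -> (p.1 = q.1 <-> p.2 = q.2).
have [|R [PR Rmax]] := @Zorn_bigcup _ P.
  move=> F FP Ftot p q [S FS Sp] [T FT Tq].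
  have [ST|TS] := Ftot _ _ FS FT.
    exact: (FP _ FT p q (ST _ Sp) Tq).
  exact: (FP _ FS p q Sp (TS _ Tq)).
have [Rtot|/existsNP[a aR]] := pselect (forall a, exists b, R (a, b)).
  left; have [g gR] := choice Rtot; exists g => a a' gaa'.
  exact/(PR _ _ (gR a) (gR a')).
right.
have Rsur b : exists a, R (a, b).
  apply: contrapT => bR; apply: (Rmax ([set (a, b)] `|` R)).
    split; first by move=> p; right.
    by move=> /(_ (a, b) (or_introl erefl)) Rab; apply: aR; exists b.
  move=> p q [->|Rp] [->|Rq] //=; last exact: PR.
  - split=> e; first by case: aR; exists q.2; rewrite e -surjective_pairing.
    by case: bR; exists q.1; rewrite e -surjective_pairing.
  - split=> e; first by case: aR; exists p.2; rewrite -e -surjective_pairing.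
    by case: bR; exists p.1; rewrite -e -surjective_pairing.
have [g gR] := choice Rsur; exists g => b b' gbb'.
exact/(PR _ _ (gR b) (gR b')).
Qed.

(** * Squares of infinite sets *)

Section square.
Context {A : Type}.

Definition carrier (R : set (A * A * A)) : set A :=
  [set a | exists p, R p /\ [\/ a = p.1.1, a = p.1.2 | a = p.2]].

(** The graph of an injection from the square of the carrier into the carrier. Kept as a set of
    triples, so that chains have literal unions. *)
Definition square_injection (R : set (A * A * A)) : Prop :=
  (forall p q, R p -> R q -> (p.1 = q.1 <-> p.2 = q.2)) /\
  (forall a b, carrier R a -> carrier R b -> exists c, R (a, b, c)).

Lemma carrier_sub (R S : set (A * A * A)) :
  R `<=` S -> carrier R `<=` carrier S.
Proof. by move=> RS a [p [/RS Sp ap]]; exists p. Qed.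

Lemma carrier_bigcup (F : set (set (A * A * A))) (a : A) :
  carrier (\bigcup_(R in F) R) a -> exists2 R, F R & carrier R a.
Proof. by move=> [p [[R FR Rp] ap]]; exists R => //; exists p. Qed.

Lemma square_injection_bigcup (F : set (set (A * A * A))) :
  F `<=` square_injection -> total_on F subset ->
  square_injection (\bigcup_(R in F) R).
Proof.
move=> FP Ftot; split.
  move=> p q [S FS Sp] [T FT Tq]; have [ST|TS] := Ftot _ _ FS FT.
    exact: ((FP _ FT).1 p q (ST _ Sp) Tq).
  exact: ((FP _ FS).1 p q Sp (TS _ Tq)).
move=> a b /carrier_bigcup[S FS Sa] /carrier_bigcup[T FT Tb].
have [/carrier_sub ST|/carrier_sub TS] := Ftot _ _ FS FT.
  by have [c Tc] := (FP _ FT).2 a b (ST _ Sa) Tb; exists c; exists T.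
by have [c Sc] := (FP _ FS).2 a b Sa (TS _ Tb); exists c; exists S.
Qed.

Lemma square_injection_nat (e : nat -> A) : injective e ->
  square_injection [set (e p.1, e p.2, e (pickle p)) | p in [set: nat * nat]].
Proof.
move=> eI; split.
  move=> _ _ [[m n] _ <-] [[m' n'] _ <-] /=.
  split=> [[/eI -> /eI ->]//|/eI/(pcan_inj (@pickleK _)) [-> ->]//].
have ce a : carrier [set (e p.1, e p.2, e (pickle p)) | p in [set: nat * nat]] a
    -> exists n, e n = a.
  by move=> [_ [[[m n] _ <-]] [] /= ->]; eexists.
move=> _ _ /ce[m <-] /ce[n <-]; exists (e (pickle (m, n))).
by exists (m, n).
Qed.

Lemma maximal_square_injection : embeds nat A ->
  exists R, [/\ square_injection R, embeds nat (carrier R) &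
    forall S, R `<` S -> ~ square_injection S].
Proof.
move=> [e eI]; have := square_injection_nat eI; set R0 := _ @` _ => R0P.
(* Putting [R0] into the predicate forces the maximal relation to contain it, which keeps the
   carrier infinite. *)
have [|R [PR Rmax]] := @Zorn_bigcup _ [set R | square_injection (R0 `|` R)].
  move=> F FP Ftot /=.
  have [->|/set0P F0] := eqVneq F set0; first by rewrite bigcup_set0 setU0.
  have -> : R0 `|` \bigcup_(X in F) X = \bigcup_(X in [set R0 `|` X | X in F]) X.
    rewrite bigcup_image; apply/seteqP; split.
      move=> p [R0p|[X FX Xp]]; last by exists X => //; right.
      by have [X FX] := F0; exists X => //; left.
    by move=> p [X FX [R0p|Xp]]; [left|right; exists X].
  apply: square_injection_bigcup; first by move=> _ [X /FP PX <-].
  move=> _ _ [X FX <-] [Y FY <-].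
  by have [XY|YX] := Ftot _ _ FX FY; [left|right]; apply: setUS.
exists (R0 `|` R); split=> //.
  have ce n : carrier (R0 `|` R) (e n).
    exists (e n, e n, e (pickle (n, n))); split; last by constructor 1.
    by left; exists (n, n).
  exists (fun n => SigSub (mem_set (ce n))) => m n /(congr1 val); exact: eI.
move=> S [RS SR] PS; apply: (Rmax S); last first.
  rewrite /= (_ : R0 `|` S = S)//; apply/setUidPr.
  by apply: subset_trans RS; exact: subsetUl.
split; first by apply: subset_trans RS; exact: subsetUr.
by move=> SR'; apply: SR; apply: subset_trans SR' _; exact: subsetUr.
Qed.

Lemma square_injection_fun (R : set (A * A * A)) : square_injection R ->
  exists h : carrier R * carrier R -> carrier R,
    injective h /\ forall p, R (val p.1, val p.2, val (h p)).
Proof.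
move=> [Rinj Rtot].
have valB (a : carrier R) : carrier R (val a) by apply: set_mem; exact: valP.
have h1 (p : carrier R * carrier R) :
    exists c : carrier R, R (val p.1, val p.2, val c).
  have [c Rc] := Rtot _ _ (valB p.1) (valB p.2).
  have cR : carrier R c by exists (val p.1, val p.2, c); split=> //; constructor 3.
  by exists (SigSub (mem_set cR)).
have [h hR] := choice h1; exists h; split=> // -[a b] [a' b'] hh.
have /= [_] := Rinj _ _ (hR (a, b)) (hR (a', b')).
by rewrite hh => /(_ erefl) [/val_inj -> /val_inj ->].
Qed.

(* If [g] injects the carrier [B] into its complement, the pairs of
   [B `|` g @` B] that are not in [B * B] can be sent to [g @` B], by coding
   which of the three remaining blocks they lie in. *)
Lemma square_injection_extend (R : set (A * A * A)) :
  square_injection R -> embeds nat (carrier R) ->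
  embeds (carrier R) (~` carrier R) -> exists2 S, R `<` S & square_injection S.
Proof.
move=> [Rinj Rtot] [e eI] [g gI].
have valB (a : carrier R) : carrier R (val a) by apply: set_mem; exact: valP.
have gN (a : carrier R) : ~ carrier R (val (g a)).
  exact: (set_mem (valP (g a))).
have [h [hI' hR]] := square_injection_fun (conj Rinj Rtot).
have hI a b a' b' : h (a, b) = h (a', b') -> a = a' /\ b = b' by move=> /hI' [].
pose pos (i : bool) (a : carrier R) : A := if i then val (g a) else val a.
have posI i j a b : pos i a = pos j b -> i = j /\ a = b.
  case: i; case: j => /=.
  - by move=> /val_inj/gI ->.
  - by move=> gab; case: (gN a); exact: (eq_ind_r (carrier R) (valB b) gab).
  - by move=> gab; case: (gN b); exact: (eq_ind (val a) (carrier R) (valB a) _ gab).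
  - by move=> /val_inj ->.
(* The number [i + j.*2] records the block, and the outer [g] keeps the new values off the old
   carrier. *)
pose val3 (i j : bool) (a b : carrier R) : A :=
  val (g (h (e (i + j.*2)%N, h (a, b)))).
have val3I i j i' j' a b a' b' : val3 i j a b = val3 i' j' a' b' ->
    (i = i' /\ j = j') /\ (a = a' /\ b = b').
  move=> /val_inj/gI/hI [/eI ij /hI ab]; split=> //.
  by move: ij; case: i; case: j; case: i'; case: j'.
pose S : set (A * A * A) := [set p | R p \/ exists i j a b,
  [/\ i || j, p.1 = (pos i a, pos j b) & p.2 = val3 i j a b]].
have RS : R `<=` S by move=> p; left.
have R1 p : R p -> carrier R p.1.1 by move=> Rp; exists p; split=> //; constructor 1.
have R2 p : R p -> carrier R p.1.2 by move=> Rp; exists p; split=> //; constructor 2.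
have R3 p : R p -> carrier R p.2 by move=> Rp; exists p; split=> //; constructor 3.
have RN p i j a b : R p -> i || j -> p.1 <> (pos i a, pos j b).
  move=> Rp ij p1; move: (R1 _ Rp) (R2 _ Rp); rewrite p1 /=.
  by move: ij; case: i {p1} => /= [_ /gN|] //; case: j => //= _ _ /gN.
have RN2 p i j a b : R p -> p.2 <> val3 i j a b.
  by move=> /R3 + p2; rewrite p2; exact: gN.
exists S.
  split=> // SR.
  have : S (pos true (e 0), pos false (e 0), val3 true false (e 0) (e 0)).
    by right; exists true, false, (e 0), (e 0).
  by move=> /SR/R3; exact: gN.
split.
  move=> p q [Rp|[i [j [a [b [ij p1 p2]]]]]] [Rq|[k [l [c [d [kl q1 q2]]]]]].
  - exact: Rinj.
  - split=> pq; first by case: (RN _ _ _ c d Rp kl); rewrite pq.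
    by case: (RN2 _ k l c d Rp); rewrite pq.
  - split=> pq; first by case: (RN _ _ _ a b Rq ij); rewrite -pq.
    by case: (RN2 _ i j a b Rq); rewrite -pq.
  - rewrite p1 q1 p2 q2; split.
      by move=> [/posI[-> ->] /posI[-> ->]].
    by move=> /val3I [[-> ->] [-> ->]].
have cS a : carrier S a -> exists i b, a = pos i b.
  have cR c : carrier R c -> exists i b, c = pos i b.
    by move=> Rc; exists false, (SigSub (mem_set Rc)).
  move=> [p [[Rp|[i [j [c [d [ij p1 p2]]]]]]]].
    by case=> ->; apply: cR; [exact: R1|exact: R2|exact: R3].
  rewrite p1 p2 => -[] -> /=; do 2?by eexists; eexists.
  by exists true; eexists.
move=> _ _ /cS[i [a ->]] /cS[j [b ->]].
have [ij|] := boolP (i || j).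
  by exists (val3 i j a b); right; exists i, j, a, b.
case: i; case: j => //= _; exists (val (h (a, b))); left; exact: hR (a, b).
Qed.

(** Let [B] be the carrier of a maximal [R]. It cannot embed in its complement, as [R] would extend;
    so the complement embeds in [B], and [A] embeds in [B * B], hence in [B]. *)
Lemma embeds_square : embeds nat A -> embeds (A * A) A.
Proof.
move=> /maximal_square_injection[R [RP Rnat Rmax]].
have sqB : embeds (carrier R * carrier R) (carrier R).
  by have [h [hI _]] := square_injection_fun RP; exists h.
have [NB|BN] := embeds_total (~` carrier R) (carrier R); last first.
  by have [S /Rmax] := square_injection_extend RP Rnat BN.
have AB : embeds A (carrier R).
  apply: embeds_trans sqB.
  have [g gI] := NB; have [e eI] := Rnat.
  exists (fun a => match pselect (carrier R a) with
    | left Ra => (e 0, SigSub (mem_set Ra))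
    | right Na => (e 1, g (SigSub (@mem_set _ (~` carrier R) a Na))) end).
  move=> a b; case: pselect => [Ra|Na]; case: pselect => [Rb|Nb] //.
  - by move=> [].
  - by move=> [/eI].
  - by move=> [/eI].
  - by move=> [/gI/(congr1 val)].
apply: embeds_trans (embeds_prod AB AB) _; apply: embeds_trans sqB _.
by exists val; exact: val_inj.
Qed.

End square.

(** Iterated pairing is injective only among sequences of equal length, so the length is recorded
    too. *)
Lemma embeds_seq (A : Type) : embeds nat A -> embeds (seq A) A.
Proof.
move=> natA; have [g gI] := embeds_square natA; have [e eI] := natA.
pose code := foldr (fun a c => g (a, c)) (e 0).
have codeI s t : size s = size t -> code s = code t -> s = t.
  elim: s t => [|a s IHs] [|b t] //= [st] /gI[-> /(IHs _ st) ->//].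
exists (fun s => g (e (size s), code s)) => s t /gI[/eI]; exact: codeI.
Qed.

Lemma embeds_sum_self (A : Type) : embeds nat A -> embeds (A + A) A.
Proof.
move=> natA; apply: embeds_trans (embeds_square natA); have [e eI] := natA.
exists (fun p => match p with inl a => (e 0, a) | inr a => (e 1, a) end).
by move=> [a|a] [b|b] [] // => [->|/eI|/eI|->].
Qed.

(** * Neighbourhoods of closed sets in compact spaces *)

(** If no [U] with [Q U] covered [A], the differences of [A] and such [U] would generate a proper
    filter; a cluster point in [A] has a neighbourhood satisfying [Q], a contradiction. *)
Lemma compact_ind (X : topologicalType) (A : set X) (Q : set X -> Prop) :
  compact A -> Q set0 -> (forall U V, Q U -> Q V -> Q (U `|` V)) ->
  (forall x, A x -> exists2 U, nbhs x U & Q U) -> exists2 U, Q U & A `<=` U.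
Proof.
move=> Aco Q0 QU QA; apply: contrapT => noU.
pose F : set_system X := [set S | exists2 U, Q U & A `\` U `<=` S].
have FA : F A by exists set0 => // x [].
have FF : ProperFilter F.
  split.
    by move=> [U QU' AU]; apply: noU; exists U => // x Ax; apply: contrapT => /(conj Ax)/AU.
  split.
  - by exists set0.
  - move=> S T [U QU' US] [V QV VT]; exists (U `|` V); first exact: QU.
    move=> x [Ax UVx]; split; first by apply: US; split=> // Ux; apply: UVx; left.
    by apply: VT; split=> // Vx; apply: UVx; right.
  - by move=> S T ST [U QU' US]; exists U => //; exact: subset_trans ST.
have [x [Ax xF]] := Aco F FF FA.
have [U xU QU'] := QA x Ax.
have FU : F (A `\` U) by exists U.
by have [y [[_ nUy] Uy]] := xF _ _ FU xU.
Qed.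

Section finite_combinations.
Context {X P : Type} (S : P -> set X).

Definition union_of (t : seq P) : set X :=
  foldr (fun p A => S p `|` A) set0 t.

(** Finite intersections of finite unions are indexed by nested sequences, so that bases made of
    them can be counted. *)
Definition cnf_of (tt : seq (seq P)) : set X :=
  foldr (fun t A => union_of t `&` A) setT tt.

Lemma union_of_cat (s t : seq P) :
  union_of (s ++ t) = union_of s `|` union_of t.
Proof. by elim: s => [|p s IHs] /=; rewrite ?set0U// IHs setUA. Qed.

Lemma cnf_of_cat (s t : seq (seq P)) :
  cnf_of (s ++ t) = cnf_of s `&` cnf_of t.
Proof. by elim: s => [|p s IHs] /=; rewrite ?setTI// IHs setIA. Qed.

End finite_combinations.

Lemma open_cnf_of (X : topologicalType) (P : Type) (S : P -> set X) tt :
  (forall p, open (S p)) -> open (cnf_of S tt).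
Proof.
move=> oS; elim: tt => [|t tt IHtt] /=; first exact: openT.
apply: openI => //; elim: t => [|p t IHt] /=; first exact: open0.
exact: openU.
Qed.

Section separating_family.
Context {X : topologicalType} {P : Type} (S : P -> set X) (C : set X).
Hypothesis Xco : compact [set: X].
Hypothesis Ccl : closed C.
Hypothesis oS : forall p, open (S p).
Hypothesis sepS : forall x y, C x -> ~ C y ->
  exists2 p, S p x & exists2 N, nbhs y N & N `&` S p = set0.

(** Compactness of [C] leaves finitely many [S p], and the matching neighbourhoods of [y] are
    intersected. *)
Lemma union_of_separates y : ~ C y ->
  exists2 t, C `<=` union_of S t & exists2 N, nbhs y N & N `&` union_of S t = set0.
Proof.
move=> Cy; have Cco : compact C by exact: subclosed_compact Ccl Xco _.
have [||x Cx|U [t Ut yt] CU] := @compact_ind _ C (fun U => exists2 t,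
    U `<=` union_of S t & exists2 N, nbhs y N & N `&` union_of S t = set0) Cco.
- by exists [::] => //=; exists setT; [exact: filterT|rewrite setI0].
- move=> U V [s Us [N yN Ns]] [t Vt [M yM Mt]]; exists (s ++ t).
    by rewrite union_of_cat; exact: setUSS.
  exists (N `&` M); first exact: filterI.
  rewrite union_of_cat setIUr {1}(setIC N) -!setIA Ns Mt.
  by rewrite !setI0 setU0.
- have [p Spx [N yN Np]] := sepS Cx Cy.
  exists (S p); first exact: open_nbhs_nbhs.
  exists [:: p]; first by move=> z Sz; left.
  by exists N => //=; rewrite setU0.
- by exists t => //; exact: subset_trans CU Ut.
Qed.

(** Compactness is used again, now on the complement of [W]: finitely many of the unions separating
    its points from [C] are intersected. *)
Lemma cnf_of_base W : open W -> C `<=` W ->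
  exists2 tt, C `<=` cnf_of S tt & cnf_of S tt `<=` W.
Proof.
move=> oW CW.
have Wco : compact (~` W).
  by apply: subclosed_compact Xco _ => //; exact: open_closedC.
have [||y Wy|U [tt Ctt Utt] WU] := @compact_ind _ (~` W) (fun U => exists2 tt,
    C `<=` cnf_of S tt & U `&` cnf_of S tt = set0) Wco.
- by exists [::] => //=; rewrite set0I.
- move=> U V [s Cs Us] [t Ct Vt]; exists (s ++ t).
    by rewrite cnf_of_cat => x Cx; split; [exact: Cs|exact: Ct].
  by rewrite cnf_of_cat setIUl setIA Us set0I (setIC (cnf_of S s)) setIA Vt set0I setU0.
- have [t Ct [N yN Nt]] : exists2 t, C `<=` union_of S t &
      exists2 N, nbhs y N & N `&` union_of S t = set0.
    by apply: union_of_separates => /CW.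
  exists N => //; exists [:: t]; first by move=> x Cx; split=> //; exact: Ct.
  by rewrite /= setIT.
- exists tt => // x xtt; apply: contrapT => /WU Ux.
  by have : set0 x by rewrite -Utt.
Qed.

End separating_family.

(** The map [f] is closed, so the complement of the image of the complement of [W] is open. *)
Lemma preimage_nbhd (X Y : topologicalType) (f : X -> Y) (K : set Y) (W : set X) :
  compact [set: X] -> hausdorff_space Y -> continuous f -> open W ->
  f @^-1` K `<=` W ->
  exists V, [/\ open V, K `<=` V & f @^-1` V `<=` W].
Proof.
move=> Xco hY cf oW KW; exists (~` (f @` (~` W))); split.
- apply: closed_openC; apply: compact_closed => //; apply: continuous_compact.
    exact: continuous_subspaceT.
  by apply: subclosed_compact Xco _ => //; exact: open_closedC.
- by move=> y Ky [x Wx fx]; apply: Wx; apply: KW; rewrite /= fx.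
- by move=> x /= fx; apply: contrapT => Wx; apply: fx; exists x.
Qed.

Lemma weight_le_family (T : topologicalType) (L : Type) : weight_le T L ->
  exists b : L -> set T, (forall l, open (b l)) /\
    forall U x, open U -> U x -> exists2 l, b l x & b l `<=` U.
Proof.
move=> [B [Bo Bb] /card_leP[g]].
(* The value at [l] is the member of [B] with index [l], or the empty set if there is none. *)
exists (fun l => [set x | exists2 c : B, val (g c) = l & val c x]); split.
  move=> l; rewrite (_ : [set x | _] = \bigcup_(c in [set c : B | val (g c) = l]) val c).
    by apply: bigcup_open => c _; apply: Bo; apply: set_mem; exact: valP.
  by apply/seteqP; split=> x [c cl cx]; exists c.
move=> U x oU Ux; have [c Bc [cx cU]] := Bb U x oU Ux.
pose c' : B := SigSub (mem_set Bc); exists (val (g c')); first by exists c'.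
move=> y [d /val_inj/(inj (in_setT d) (in_setT c')) -> cy]; exact: cU.
Qed.

(** * Noetherian bases *)

(* An order of type the initial ordinal of [|L|]: a well-order of [L],
   transported to its shortest initial segment of full cardinality. *)
Lemma initial_well_order (L : Type) : embeds nat L ->
  exists le : L -> L -> Prop,
    (forall A : set L, A !=set0 -> exists2 m, A m & forall x, A x -> le m x) /\
    (forall l, ~ exists g : L -> L, injective g /\ forall x, le (g x) l).
Proof.
move=> natL; have [R Rwo] := well_ordering_principle {classic L}.
have Rmin (A : set L) : A !=set0 -> exists2 m, A m & forall x, A x -> R m x.
  move=> [a Aa]; have [|m [[mA mle] _]] := Rwo (mem A).
    by exists a; apply/mem_set.
  by exists m; [exact: set_mem|move=> x Ax; apply: mle; exact: mem_set].
have Ranti x y : R x y -> R y x -> x = y.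
  have Rch : wo_chain R predT by apply: withinW.
  by move=> xy yx; apply: (wo_chain_antisymmetric Rch); rewrite ?xy.
pose large a := exists g : L -> L, injective g /\ forall x, R (g x) a.
(* If no segment is large, [R] itself serves; otherwise the segment up to the least large [a0] is
   used. *)
have [nolarge|[a0 [j [jI ja0]] a0min]] : (forall a, ~ large a) \/
    exists2 a0, large a0 & forall a, large a -> R a0 a.
  have [[a la]|nl] := pselect (exists a, large a); last first.
    by left=> a la; apply: nl; exists a.
  by right; apply: Rmin; exists a.
  by exists R.
(* Doubling [L] gives two injections into this segment with disjoint ranges, so one of them misses
   [a0]. *)
have [k [kI ka0 kN]] : exists k : L -> L,
    [/\ injective k, forall x, R (k x) a0 & forall x, k x <> a0].
  have [s sI] := embeds_sum_self natL.
  have [[x0 x0a]|nx] := pselect (exists x, j (s (inl x)) = a0).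
    exists (fun x => j (s (inr x))); split=> //.
      by move=> x y /jI/sI[].
    by move=> x; rewrite -x0a => /jI/sI.
  exists (fun x => j (s (inl x))); split=> //.
    by move=> x y /jI/sI[].
  by move=> x xa; apply: nx; exists x.
exists (fun x y => R (k x) (k y)); split.
  move=> A [a Aa].
  have [|_ [m Am <-] mmin] := Rmin (k @` A); first by exists (k a); exists a.
  by exists m => // x Ax; apply: mmin; exists x.
move=> l [g [gI gl]]; apply: (kN l); apply: Ranti; first exact: ka0.
apply: a0min; exists (k \o g); split=> //; exact: inj_comp.
Qed.

Definition has_base_indexed (T : topologicalType) (E : set T) (A : Type) : Prop :=
  exists q : A -> set T, (forall a, open (q a) /\ E `<=` q a) /\
    forall W, open W -> E `<=` W -> exists a, q a `<=` W.

(** Indices outside the range of [g] are given the whole space. *)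
Lemma has_base_indexed_embeds (T : topologicalType) (E : set T) (A B : Type) :
  embeds A B -> has_base_indexed E A -> has_base_indexed E B.
Proof.
move=> [g gI] [q [qE qb]].
have h1 b : exists V, [/\ open V, E `<=` V & forall a, g a = b -> V = q a].
  have [[a ab]|na] := pselect (exists a, g a = b).
    exists (q a); split; try exact: (qE a).1; try exact: (qE a).2.
    by move=> a' a'b; congr q; apply: gI; rewrite ab.
  exists setT; split=> //; first exact: openT.
  by move=> a ab; case: na; exists a.
have [r rP] := choice h1; exists r; split; first by move=> b; case: (rP b).
move=> W oW EW; have [a aW] := qb W oW EW; exists (g a).
by have [_ _ /(_ a erefl) ->] := rP (g a).
Qed.

(** The least index of a member inside [W] is kept, so a base remains. A kept [q l'] containing
    [q l] has [le l' l], and the indices up to [l] are too few for [L]. *)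
Lemma chiNt_le_indexed (T : topologicalType) (E : set T) (L : Type) :
  embeds nat L -> has_base_indexed E L -> chiNt_le E L.
Proof.
move=> natL [q [qE qb]]; have [le [lemin lesmall]] := initial_well_order natL.
pose D := [set l | forall l', q l' `<=` q l -> le l l'].
exists (q @` D).
  split; first by move=> _ [l _ <-].
  move=> W oW EW; have [|m mW mmin] := lemin [set l | q l `<=` W].
    exact: qb.
  exists (q m) => //; exists m => // l lm; apply: mmin.
  exact: subset_trans mW.
move=> _ [l Dl <-] /setT_card_leP[g [gI gP]]; apply: (lesmall l).
have h1 x : exists l', q l' = g x /\ le l' l.
  by have [[l' Dl' l'x] lx] := gP x; exists l'; split=> //; apply: Dl'; rewrite l'x.
have [h hP] := choice h1; exists h; split; last by move=> x; exact: (hP x).2.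
by move=> x y hxy; apply: gI; rewrite -(hP x).1 -(hP y).1 hxy.
Qed.

(** A superset [q h & U h] of a given member has [U h] containing that member, which leaves finitely
    many [h]. *)
Lemma chiNt_le_sparse (T : topologicalType) (E : set T) (L G : Type)
    (U : G -> set T) :
  infinite_set [set: L] -> has_base_indexed E G ->
  (forall g, open (U g) /\ E `<=` U g) ->
  (forall V, open V -> E `<=` V -> finite_set [set g | V `<=` U g]) ->
  chiNt_le E L.
Proof.
move=> Linf [q [qE qb]] UE Ufin.
exists (range (fun g => q g `&` U g)).
  split.
    move=> _ [g _ <-]; have [oq Eq] := qE g; have [oU EU] := UE g.
    by split; [exact: openI|move=> x Ex; split; [exact: Eq|exact: EU]].
  move=> W oW EW; have [g gW] := qb W oW EW; exists (q g `&` U g); first by exists g.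
  by move=> x [/gW].
move=> _ [g _ <-] /card_le_finite Lfin; apply: Linf; apply: Lfin.
have [oq Eq] := qE g; have [oU EU] := UE g.
have fin : finite_set [set h | q g `&` U g `<=` U h].
  by apply: Ufin; [exact: openI|move=> x Ex; split; [exact: Eq|exact: EU]].
apply: sub_finite_set (finite_image (fun h => q h `&` U h) fin).
by move=> V [[h _ <-] gh]; exists h => // x /gh[].
Qed.

(** * Closed sets in a product of compacta *)

Section product_image.
Context {I : choiceType} {X : I -> topologicalType} {L : Type}.
Context {b : forall i, L -> set (X i)}.
Hypothesis Xco : forall i, compact [set: X i].
Hypothesis hX : forall i, hausdorff_space (X i).
Hypothesis ob : forall i l, open (@b i l).
Hypothesis bb : forall i (U : set (X i)) x, open U -> U x ->
  exists2 l, b l x & @b i l `<=` U.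

Lemma prod_compact : compact [set: prod_topology X].
Proof.
have := @tychonoff I X (fun i => setT) Xco.
by congr (compact _); apply/seteqP; split.
Qed.

Definition cylinder (i : I) (l : L) : set (prod_topology X) :=
  [set x | b l (x i)].

Lemma open_cylinder i l : open (cylinder i l).
Proof.
by apply: (@open_comp (prod_topology X) _ (proj i)) => // x _; exact: proj_continuous.
Qed.

Lemma cylinder_separates (x y : prod_topology X) (i : I) : x i <> y i ->
  exists2 l, cylinder i l x & exists2 N, nbhs y N & N `&` cylinder i l = set0.
Proof.
move=> /eqP xy; have := @hX i; rewrite open_hausdorff => /(_ _ _ xy).
move=> [[A B] /= [/set_mem Ax /set_mem By] [oA oB /eqP AB]].
have [l lx lA] := bb oA Ax; exists l => //.
exists (proj i @^-1` B).
  apply: open_nbhs_nbhs; split => //.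
  by apply: (@open_comp (prod_topology X) _ (proj i)) => // z _; exact: proj_continuous.
apply/seteqP; split=> // z [Bz lz].
by have : set0 (z i) by rewrite -AB; split=> //; exact: lA.
Qed.

Section closed_set.
Context {C : set (prod_topology X)}.
Hypothesis Ccl : closed C.

Definition critical (s : seq I) : Prop :=
  exists x y : prod_topology X,
    [/\ C x, ~ C y & forall i, i \notin s -> x i = y i].

Definition cyl (p : I * L) := cylinder p.1 p.2.

Lemma cyl_separates x y : C x -> ~ C y ->
  exists2 p, cyl p x & exists2 N, nbhs y N & N `&` cyl p = set0.
Proof.
move=> Cx Cy; have [xy|/existsNP[i xyi]] := pselect (forall i, x i = y i).
  by case: Cy; rewrite -(_ : x = y)//; apply: functional_extensionality_dep.
by have [l lx lN] := cylinder_separates xyi; exists (i, l).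
Qed.

Lemma union_of_cyl_support (t : seq (I * L)) x y :
  (forall i, i \in map fst t -> x i = y i) ->
  union_of cyl t x -> union_of cyl t y.
Proof.
elim: t => [|p t IHt] //= xy [px|tx].
  by left; rewrite /cyl/cylinder /= -xy ?mem_head.
by right; apply: IHt tx => i it; apply: xy; rewrite in_cons it orbT.
Qed.

Lemma cnf_of_cyl_support (tt : seq (seq (I * L))) x y :
  (forall i, i \in map fst (flatten tt) -> x i = y i) ->
  cnf_of cyl tt x -> cnf_of cyl tt y.
Proof.
elim: tt => [|t tt IHtt] //= xy [tx ttx]; split.
  by apply: union_of_cyl_support tx => i it; apply: xy; rewrite map_cat mem_cat it.
by apply: IHtt ttx => i it; apply: xy; rewrite map_cat mem_cat it orbT.
Qed.

Context {E : set (seq I)}.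
Hypothesis Emax :
  maximal_disjoint_subcollection (fun s : seq I => [set` s]) E critical.

(* Otherwise two points agreeing on the coordinates in [E] but separated by [C]
   could be made to agree on all but finitely many coordinates, and these
   coordinates would form a critical sequence disjoint from [E]. *)
Lemma closed_depends x y : C x ->
  (forall s i, E s -> i \in s -> x i = y i) -> C y.
Proof.
move=> Cx xy; apply: contrapT => Cy; have [Ecrit Etriv Emx] := Emax.
have [t Ct [N /nbhs_singleton Ny Nt]] := union_of_separates prod_compact Ccl
  (fun p => open_cylinder p.1 p.2) cyl_separates Cy.
have ty : ~ union_of cyl t y by move=> ty; have : set0 y by rewrite -Nt.
pose J := [set i | exists2 s, E s & i \in s].
pose s := [seq i <- map fst t | ~~ `[< J i >]].
(* Since [x] and [y] agree on [J], [y'] agrees with [y] on every coordinate of [t], yet differs from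
   [x] only on [s]. *)
pose y' : prod_topology X := fun i => if i \in s then y i else x i.
have Cy' : ~ C y'.
  move=> /Ct ty'; apply: ty; apply: union_of_cyl_support ty' => i it.
  rewrite /y' mem_filter it andbT; case: asboolP => //= -[u Eu iu].
  exact: xy Eu iu.
have scrit : critical s.
  by exists x, y'; split=> // i /negbTE is_; rewrite /y' is_.
have sJ i : i \in s -> ~ J i by rewrite mem_filter => /andP[/asboolP].
(* If [s] were in [E] it would lie inside [J], hence be empty, making [y'] equal to [x]. *)
have sE : ~ E s.
  move=> Es; apply: Cy'; rewrite (_ : y' = x)//.
  apply: functional_extensionality_dep => i; rewrite /y'; case: ifPn => // is_.
  by case: (sJ i is_); exists s.
apply: (Emx (s |` E)).
- split; first by move=> u; right.
  by move=> /(_ s (or_introl erefl)).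
- by move=> u [->|/Ecrit].
- move=> u v [->|Eu] [->|Ev] // [i [/= iu iv]].
  + by case: (sJ i iu); exists v.
  + by case: (sJ i iv); exists u.
  + by apply: Etriv => //; exists i.
Qed.

(** A coordinate in the union of [E] is named by a member of [E] and a position in it, to bound the
    number of cylinders; positions past the end give the empty set. *)
Definition indexed_cylinder (p : E * nat * L) : set (prod_topology X) :=
  if onth (val p.1.1) p.1.2 is Some i then cylinder i p.2 else set0.

Lemma open_indexed_cylinder p : open (indexed_cylinder p).
Proof.
rewrite /indexed_cylinder; case: onth => [i|]; [exact: open_cylinder|exact: open0].
Qed.

Lemma indexed_cylinder_separates x y : C x -> ~ C y ->
  exists2 p, indexed_cylinder p x &
    exists2 N, nbhs y N & N `&` indexed_cylinder p = set0.
Proof.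
move=> Cx Cy.
have [s [i [Es is_ xyi]]] : exists s i, [/\ E s, i \in s & x i <> y i].
  apply: contrapT => nsi; apply: Cy; apply: closed_depends Cx _ => s i Es is_.
  by apply: contrapT => xyi; apply: nsi; exists s, i.
have /onthP[n sn] := is_; have [l lx lN] := cylinder_separates xyi.
by exists (SigSub (mem_set Es), n, l); rewrite /indexed_cylinder /= sn.
Qed.

(** * Neighbourhoods of [K] in the image *)

Context {Y : topologicalType} {f : prod_topology X -> Y} {K : set Y}.
Hypothesis hY : hausdorff_space Y.
Hypothesis cf : continuous f.
Hypothesis fsurj : forall y, exists x, f x = y.
Hypothesis CE : C = f @^-1` K.

Lemma image_base : has_base_indexed K (seq (seq (E * nat * L))).
Proof.
(* A [tt] whose set does not contain [C] is assigned all of [Y]. *)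
have h1 tt : exists V, [/\ open V, K `<=` V & C `<=` cnf_of indexed_cylinder tt ->
    f @^-1` V `<=` cnf_of indexed_cylinder tt].
  have [Ctt|nC] := pselect (C `<=` cnf_of indexed_cylinder tt); last first.
    by exists setT; split=> //; exact: openT.
  have [|V [oV KV Vtt]] := preimage_nbhd (K := K) prod_compact hY cf
    (open_cnf_of tt open_indexed_cylinder).
    by rewrite -CE.
  by exists V.
have [q qP] := choice h1; exists q; split; first by move=> tt; have [] := qP tt.
move=> W oW KW.
have [||tt Ctt ttW] := cnf_of_base prod_compact Ccl open_indexed_cylinder
  indexed_cylinder_separates (W := f @^-1` W).
- by apply: open_comp => // x _; exact: cf.
- by rewrite CE => x; exact: KW.
exists tt => y qy; have [x xy] := fsurj y; rewrite -xy.
by apply: ttW; have [_ _ /(_ Ctt)] := qP tt; apply; rewrite /= xy.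
Qed.

Lemma sparse_nbhds : exists U : E -> set Y,
  (forall s, open (U s) /\ K `<=` U s) /\
  forall V, open V -> K `<=` V -> finite_set [set s | V `<=` U s].
Proof.
have [Ecrit Etriv _] := Emax.
have h1 (s : E) : exists p : prod_topology X * prod_topology X,
    [/\ C p.1, ~ C p.2 & forall i, i \notin val s -> p.1 i = p.2 i].
  by have [x [y [? ? ?]]] := Ecrit _ (set_mem (valP s)); exists (x, y).
have [p pP] := choice h1; exists (fun s => ~` [set f (p s).2]); split.
  move=> s; split.
    apply: closed_openC; apply: accessible_closed_set1.
    exact: hausdorff_accessible.
  by move=> y Ky fy; have [_ + _] := pP s; apply; rewrite CE /= -fy.
move=> V oV KV.
have [||tt Ctt ttV] := cnf_of_base prod_compact Ccl (fun p => open_cylinder p.1 p.2)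
  cyl_separates (W := f @^-1` V).
- by apply: open_comp => // x _; exact: cf.
- by rewrite CE => x; exact: KV.
pose F := map fst (flatten tt).
(* If [s] misses the support [F], passing from [(p s).1] to [(p s).2] stays in the preimage of [V],
   so [V] contains the point removed from [U s]. *)
apply: (@sub_finite_set _ _ (\bigcup_(i in [set` F]) [set s : E | i \in val s])).
  move=> s Vs; apply: contrapT => nF; have [Cx Cy xy] := pP s.
  apply: (Vs (f (p s).2)) => //; apply: ttV; apply: cnf_of_cyl_support (Ctt _ Cx).
  by move=> i iF; apply: xy; apply/negP => is_; apply: nF; exists i.
apply: bigcup_finite; first exact: finite_seq.
(* By disjointness at most one member of [E] contains [i]. *)
move=> i _; have [[s is_]|ns] := pselect (exists s : E, i \in val s); last first.
  apply: sub_finite_set (finite_set0 E) => s is_; apply: ns; by exists s.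
apply: sub_finite_set (finite_set1 s) => u iu; apply: val_inj.
apply: Etriv; [exact: (set_mem (valP u))|exact: (set_mem (valP s))|].
by exists i.
Qed.

Lemma chiNt_le_image : infinite_set [set: L] -> chiNt_le K L.
Proof.
move=> Linf; have natL : embeds nat L by apply/embedsP/infiniteP.
have natA : embeds nat (E + L).
  by apply: embeds_trans natL _; exists inr => x y [].
have base : has_base_indexed K (E + L).
  apply: has_base_indexed_embeds image_base.
  have sqA := embeds_square natA.
  apply: embeds_trans (embeds_seq natA); apply: embeds_map_seq.
  apply: embeds_trans (embeds_seq natA); apply: embeds_map_seq.
  apply: (embeds_trans _ sqA); apply: embeds_prod; last by exists inr => x y [].
  apply: (embeds_trans _ sqA); apply: embeds_prod => //.
  by exists inl => x y [].
(* The sum [E + L] embeds in the larger summand: in [L] the well-order argument applies, in [E] the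
   sparse neighbourhoods do. *)
have [EL|LE] := embeds_total E L.
  apply: chiNt_le_indexed => //; apply: has_base_indexed_embeds base.
  apply: embeds_trans (embeds_sum_self natL); apply: embeds_sum => //.
  by exists id.
have [U [UK Ufin]] := sparse_nbhds.
apply: (chiNt_le_sparse Linf _ UK Ufin); apply: has_base_indexed_embeds base.
apply: embeds_trans (embeds_sum_self (embeds_trans natL LE)).
by apply: embeds_sum => //; exists id.
Qed.

End closed_set.
End product_image.

(* For every infinite cardinal |L| >= sup_i w(X_i): chi_K Nt(Y) <= |L|;
   equivalently chi_K Nt(Y) <= sup_i w(X_i). *)
Theorem theorem2p19 (I : Type) (X : I -> topologicalType) (Y : topologicalType)
  (f : prod_topology X -> Y) (L : Type) :
  (forall i, compactum (X i)) ->
  hausdorff_space Y ->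
  continuous f -> (forall y : Y, exists x, f x = y) ->
  infinite_set [set: L] ->
  (forall i, weight_le (X i) L) ->
  chiKNt_le Y L.
Proof.
move=> Xcomp hY cf fsurj Linf XL K Kco.
have Kcl : closed (f @^-1` K).
  apply: closed_comp; first by move=> x _; exact: cf.
  exact: compact_closed.
pose b i := sval (cid (weight_le_family (XL i))).
have bP i : (forall l, open (b i l)) /\
    forall U x, open U -> U x -> exists2 l, b i l x & b i l `<=` U.
  exact: svalP (cid (weight_le_family (XL i))).
(* [{classic I}] equips [I] with the equality test behind membership in a sequence of
   coordinates. *)
have [E Emax] := @ex_maximal_disjoint_subcollection _ _
  (fun s : seq {classic I} => [set` s]) (@critical {classic I} X (f @^-1` K)).
exact: (@chiNt_le_image {classic I} X L b (fun i => (Xcomp i).1)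
  (fun i => (Xcomp i).2) (fun i => (bP i).1) (fun i => (bP i).2)
  (f @^-1` K) Kcl E Emax Y f K hY cf fsurj erefl Linf).
Qed.
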